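(* Let $T$ be a tree. A symbol is $F$-admissible (for $T$) if and only if it is reduced and has no gaps.
   Context: Setting. $T$ is a finite tree on the vertex set $\{x_1,\dots,x_n\}$, $K$ is a field, $R=K[x_1,\dots,x_n]$, and $I=I(T)$ is the ideal generated by the edge monomials $x_ix_j$ with $\{x_i,x_j\}$ an edge of $T$ (edges are identified with their monomials). The vertex $x_1$ is fixed as root. The vertices at distance $i$ from $x_1$ (vertices of rank $i$) are listed as $x_1^{(i)},\dots,x_{s_i}^{(i)}$; so $x_1^{(0)}=x_1$. The indeterminates are ordered by $x_1^{(0)}>x_1^{(1)}>\cdots>x_{s_1}^{(1)}>x_1^{(2)}>\cdots>x_{s_2}^{(2)}>\cdots$, the indices $(i)_p$ of the vertices $x^{(i)}_p$ are ordered in the same way, and monomials are ordered by the induced lexicographic order. $S$ is the sequence of all edge monomials of $T$ in decreasing order. Symbols. A symbol is a subsequence $u=(\mu_1,\dots,\mu_r)$ of $S$ (treated as an ordered set); a subsymbol is a subsequence of $u$. The symbol $u=(\mu_1,\dots,\mu_r)$ is reduced if $\mu_q$ does not divide $\mathrm{lcm}(\mu_1,\dots,\widehat{\mu_q},\dots,\mu_r)$ for all $1\le q\le r$. Gaps. Let $x,y,z,w$ be four distinct vertices with $xy,zw\in u$, $xy>zw$ and $xz\in I$. The monomials $xy$ and $zw$ form a gap in $u$ if $xz\notin u$, no monomial of $u$ other than $zw$ is divisible by $w$, and no monomial of $u$ smaller than $zw$ is divisible by $y$. $F$-admissible symbols. For each vertex $x^{(i)}_p$ let $K^{(i)}_p$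 be the set of edges of $T$ containing $x^{(i)}_p$. $F$-admissible symbols are those produced by the following procedure. (I) Select a descending sequence of indices $(i_1)_{p_1},\dots,(i_t)_{p_t}$ not containing any pair of indices corresponding to adjacent vertices of $T$. (II) Take all edge monomials in $K^{(i_1)}_{p_1},\dots,K^{(i_t)}_{p_t}$. (III) In the resulting symbol, cancel every monomial $\mu$ such that $\mu\in K^{(i_h)}_{p_h}$ for some $h$ and $\mu$ is not coprime to an element $\nu$ of the symbol with $\nu\in K^{(i_k)}_{p_k}$ for some $k>h$. (IV) Take all subsymbols of the symbols obtained. (V) Discard all symbols that contain a gap. *)

(* Defs.v *)
From mathcomp Require Import all_boot all_order all_algebra.
From mathcomp Require Import mpoly.

Set Implicit Arguments.
Unset Strict Implicit.
Unset Printing Implicit Defensive.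

Import GRing.Theory.
Local Open Scope ring_scope.

Section Trees.
Variables (n : nat) (T : rel 'I_n.+1).

Definition tree : Prop :=
  [/\ ssrbool.symmetric T, irreflexive T,
      (forall v w, connect T v w) &
      (forall c : seq 'I_n.+1, ucycle T c -> (size c <= 2)%N)].

Definition walk (k : nat) (v w : 'I_n.+1) : bool :=
  [exists p : k.-tuple 'I_n.+1, path T v p && (last v p == w)].

(* A shortest walk has length at most n; for vertices in different components
   the value is n.+1. *)
Definition dist (v w : 'I_n.+1) : nat :=
  find (fun k => walk k v w) (iota 0 n.+1).

(* The root x_1 is ord0. *)
Definition rank (v : 'I_n.+1) : nat := dist ord0 v.

(* x^{(i)}_p is the item of index p - 1 of L i. *)
Definition rank_listing (L : nat -> seq 'I_n.+1) : Prop :=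
  forall i, uniq (L i) /\ (forall v, (v \in L i) = (rank v == i)).

Definition edge_mon (v w : 'I_n.+1) : 'X_{1..n.+1} := (U_(v) + U_(w))%MM.

Definition edge_mons : seq 'X_{1..n.+1} :=
  undup [seq edge_mon e.1 e.2 | e : 'I_n.+1 * 'I_n.+1 in [pred e | T e.1 e.2]].

Definition edge_ideal (K : fieldType) (f : {mpoly K[n.+1]}) : Prop :=
  exists c : 'X_{1..n.+1} -> {mpoly K[n.+1]},
    f = \sum_(m <- edge_mons) c m * 'X_[m].

Variable L : nat -> seq 'I_n.+1.

(* Vertices of smaller rank, and within one rank those listed first, are the
   larger indeterminates. *)
Definition vgt (v w : 'I_n.+1) : bool :=
  (rank v < rank w)%N
  || ((rank v == rank w) && (index v (L (rank v)) < index w (L (rank v)))%N).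

(* The order that the library puts on monomials is a different one. *)
Definition mgt (m1 m2 : 'X_{1..n.+1}) : bool :=
  [exists v, (m2 v < m1 v)%N && [forall w, vgt w v ==> (m1 w == m2 w)]].

Definition edge_sequence : seq 'X_{1..n.+1} :=
  sort (fun m1 m2 => (m1 == m2) || mgt m1 m2) edge_mons.

Definition symbol (u : seq 'X_{1..n.+1}) : Prop := subseq u edge_sequence.

(* A symbol has no repetition, so [rem m u] omits m. *)
Definition reduced (u : seq 'X_{1..n.+1}) : Prop :=
  forall m, m \in u -> ~~ (m <= \big[@mlcm n.+1/0%MM]_(m' <- rem m u) m')%MM.

Definition forms_gap (K : fieldType) (u : seq 'X_{1..n.+1})
    (x y z w : 'I_n.+1) : Prop :=
  uniq [:: x; y; z; w]
  /\ [/\ edge_mon x y \in u, edge_mon z w \in u,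
         mgt (edge_mon x y) (edge_mon z w) &
         edge_ideal ('X_x * 'X_z : {mpoly K[n.+1]})]
  /\ [/\ edge_mon x z \notin u,
         (forall m, m \in u -> m != edge_mon z w -> ~~ (U_(w) <= m)%MM) &
         (forall m, m \in u -> mgt (edge_mon z w) m -> ~~ (U_(y) <= m)%MM)].

Definition has_gap (K : fieldType) (u : seq 'X_{1..n.+1}) : Prop :=
  exists x y z w, forms_gap K u x y z w.

Definition mcoprime (m1 m2 : 'X_{1..n.+1}) : bool :=
  [forall v, minn (m1 v) (m2 v) == 0%N].

Definition star (v : 'I_n.+1) : seq 'X_{1..n.+1} :=
  [seq m <- edge_sequence | (U_(v) <= m)%MM].

Definition stars_union (c : seq 'I_n.+1) : seq 'X_{1..n.+1} :=
  [seq m <- edge_sequence | has (fun v => m \in star v) c].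

(* All cancellations are made at once, against the full symbol
   [stars_union c]. *)
Definition stars_cancel (c : seq 'I_n.+1) : seq 'X_{1..n.+1} :=
  [seq m <- stars_union c |
     ~~ [exists h : 'I_(size c), exists k : 'I_(size c),
          [&& (h < k)%N, m \in star (tnth (in_tuple c) h) &
              has (fun m' => (m' \in star (tnth (in_tuple c) k))
                             && ~~ mcoprime m m')
                  (stars_union c)]]].

Definition F_admissible (K : fieldType) (u : seq 'X_{1..n.+1}) : Prop :=
  exists c : seq 'I_n.+1,
    [/\ sorted vgt c, {in c &, forall v w, ~~ T v w},
        subseq u (stars_cancel c) & ~ has_gap K u].

End Trees.

(* Main.v *)
Require Import Defs.
From mathcomp Require Import all_boot all_order all_algebra.
From mathcomp Require Import mpoly.

Set Implicit Arguments.
Unset Strict Implicit.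
Unset Printing Implicit Defensive.

(** Why the theorem holds.  An edge monomial of [u] divides the lcm of the others
    exactly when both of its vertices lie on other edges of [u].  So [u] is
    reduced if and only if every edge of [u] has a _private_ vertex, one that no
    other edge of [u] contains ([reducedP]); that is, [u] is a disjoint union of
    stars.

    From admissible to reduced: let [va] survive the cancellation, with [v] a
    selected vertex.  If another surviving edge contained [a], it would be [aw]
    with [w] selected as well, and the one whose selected vertex comes first in
    the descending sequence would have been cancelled because of the other
    ([stars_cancel_same_center]).  So [a] is private.

    From reduced without gaps to admissible: select the centre of each star of
    [u], where the centre of a one-edge star is its larger vertex.  Two things
    can go wrong: two centres are adjacent ([centers_indep]), or an edge [va] of
    the star centred at [v] is cancelled because [a] is adjacent in the tree to
    a smaller centre [w] ([center_last]).  Let [v > w] be the two centres, with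
    edges [va] and [wb] of [u] whose leaves [a] and [b] are private.  In a tree,
    at most one neighbour of [w] has rank at most that of [w]
    ([neighbor_rank_le_inj]); this is [v] in the first case and [a] in the
    second, so [b] lies below [w] and [v > w > b].  Hence every edge at [v]
    exceeds [wb], and since [b] is private the edges [va] and [wb] form a gap,
    joined by [vw] in the first case and by [aw] in the second. *)

(** * Ranks in a tree *)

Section Rank.
Variables (n : nat) (T : rel 'I_n.+1).
Implicit Types a b v w : 'I_n.+1.

Lemma rank_le k v : walk T k ord0 v -> rank T v <= k.
Proof.
move=> kv; rewrite /rank /dist; case: (leqP k n) => [kn|nk].
  rewrite leqNgt; apply/negP => /(before_find 0).
  by rewrite nth_iota // add0n kv.
by apply: leq_trans (find_size _ _) _; rewrite size_iota.
Qed.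

Hypothesis hT : tree T.

Lemma walk_rank v : walk T (rank T v) ord0 v.
Proof.
have [_ _ Tc _] := hT.
have /connectP[p Tp ->] := Tc ord0 v.
case/shortenP: Tp => q Tq uq _.
have qn : size q < n.+1.
  by have := uniq_leq_size uq (fun x _ => mem_enum 'I_n.+1 x); rewrite size_enum_ord.
set w := last _ _.
have hasq : has (fun k => walk T k ord0 w) (iota 0 n.+1).
  apply/hasP; exists (size q); first by rewrite mem_iota.
  by apply/existsP; exists (in_tuple q); rewrite /= Tq eqxx.
have := nth_find 0 hasq; rewrite nth_iota // -[X in _ < X](size_iota 0 n.+1).
by rewrite -has_find.
Qed.

Lemma ex_parent v : v != ord0 -> exists2 a, T v a & rank T a < rank T v.
Proof.
have [Ts _ _ _] := hT.
have := walk_rank v; case rv: (rank T v) => [|k] /existsP[p /andP[Tp /eqP vE]] v0.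
  by case/eqP: v0; rewrite -vE (tuple0 p).
case: p Tp vE => p; case/lastP: p => [//|p x] /=.
rewrite size_rcons eqSS rcons_path last_rcons => sp /andP[Tp Tx] xv.
exists (last ord0 p); first by rewrite Ts -xv.
by rewrite ltnS; apply: rank_le; apply/existsP; exists (Tuple sp); rewrite /= Tp /=.
Qed.

(** Climbing from parent to parent strictly decreases the rank, so the climb from
    [a] to the root can never meet [v]. *)
Lemma connect_root_avoiding v a : a != v -> rank T a <= rank T v ->
  connect [rel x y | [&& T x y, x != v & y != v]] a ord0.
Proof.
move: {2}(rank T a).+1 (ltnSn (rank T a)) => k.
elim: k a => // k IHk a; rewrite ltnS => ak av rav.
have [->|a0] := eqVneq a ord0; first exact: connect0.
have [b Tab rba] := ex_parent a0.
have bv : b != v by apply: contraTneq rav => <-; rewrite -ltnNge.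
have rbv : rank T b <= rank T v by exact: leq_trans (ltnW rba) rav.
apply: connect_trans (IHk b (leq_trans rba ak) bv rbv).
by apply: connect1; rewrite /= Tab av bv.
Qed.

(** Uniqueness of parents.  Two distinct such neighbours would be joined by a
    path through the root that avoids [v], closing a cycle at [v].  The
    inequalities are not strict, so this also excludes edges between vertices of
    equal rank. *)
Lemma neighbor_rank_le_inj v a b : T v a -> T v b ->
  rank T a <= rank T v -> rank T b <= rank T v -> a = b.
Proof.
move=> Tva Tvb ra rb; have [Ts Ti _ Tcyc] := hT.
apply/eqP/negPn/negP => ab.
have Tne w : T v w -> w != v by apply: contraTneq => ->; rewrite Ti.
pose e := [rel x y | [&& T x y, x != v & y != v]].
have esym : connect_sym e.
  by apply: sym_connect_sym => x y /=; rewrite Ts [(x != v) && _]andbC.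
have : connect e a b.
  apply: connect_trans (connect_root_avoiding (Tne _ Tva) ra) _.
  by rewrite esym; apply: connect_root_avoiding (Tne _ Tvb) rb.
case/connectP => p ep bE; case/shortenP: ep bE => q eq uq _ bE.
have Tq : path T a q by apply: sub_path eq => x y /= /and3P[].
have vq : v \notin a :: q.
  rewrite inE eq_sym (negbTE (Tne _ Tva)) /=.
  elim: q (a) eq {uq bE Tq} => //= x q IHq y /andP[/and3P[_ _ xv] eq].
  by rewrite inE eq_sym (negbTE xv) (IHq x).
have := Tcyc (v :: a :: q); rewrite /ucycle /= rcons_path -bE Tva Tq Ts Tvb.
case: q bE {eq Tq} uq vq => [bE|x q _ uq vq]; first by rewrite bE eqxx in ab.
by rewrite vq -/(uniq (a :: _)) uq; move=> /(_ isT).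
Qed.
End Rank.

(** * Edge monomials and reduced symbols *)

Section Monomials.
Variable n : nat.
Implicit Types (v w a b t : 'I_n.+1) (m : 'X_{1..n.+1}) (u : seq 'X_{1..n.+1}).

Lemma edge_monC v w : edge_mon v w = edge_mon w v.
Proof. exact: addmC. Qed.

Lemma edge_monE v w t : edge_mon v w t = (v == t) + (w == t).
Proof. by rewrite mnmDE !mnm1E. Qed.

Lemma dvd_edge_mon t v w : (U_(t) <= edge_mon v w)%MM = (t == v) || (t == w).
Proof.
by rewrite lep1mP edge_monE addn_eq0 !eqb0 negb_and !negbK ![t == _]eq_sym.
Qed.

Lemma edge_mon_inj v w a : edge_mon v a = edge_mon w a -> v = w.
Proof.
move/eqP; rewrite eqm_add2r => /eqP/(congr1 (fun m : 'X_{1..n.+1} => m v)).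
by rewrite !mnm1E eqxx; case: eqP.
Qed.

Lemma edge_mon_le1 v w t : v != w -> edge_mon v w t <= 1.
Proof.
by rewrite edge_monE => vw; case: (eqVneq v t) vw => [->|_ _]; rewrite ?[w == t]eq_sym;
  [move/negbTE->|case: eqP].
Qed.

Lemma dvd_big_lcm t u :
  (U_(t) <= \big[@mlcm n.+1/0%MM]_(m <- u) m)%MM = has (fun m => (U_(t) <= m)%MM) u.
Proof.
elim: u => [|m u IHu]; first by rewrite big_nil lep1mP mnmE.
rewrite big_cons /= -IHu !lep1mP /mlcm mnmE -!lt0n.
by rewrite leq_max.
Qed.

Definition private u a m := all (fun m' => (U_(a) <= m')%MM ==> (m' == m)) u.

Lemma privateP u a m m' : private u a m -> m' \in u -> (U_(a) <= m')%MM -> m' = m.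
Proof. by move=> /allP pm um' am'; move: (pm _ um'); rewrite am' => /eqP. Qed.

(** For squarefree monomials, [m] fails to divide the lcm of the others exactly
    when some variable of [m] is absent from that lcm. *)
Lemma reducedP u : uniq u -> {in u, forall m t, m t <= 1} ->
  reduced u <-> {in u, forall m, exists2 a, (U_(a) <= m)%MM & private u a m}.
Proof.
move=> uu u1; split=> red m um.
  have /existsP[a lt] : [exists a, (\big[@mlcm n.+1/0%MM]_(m'' <- rem m u) m'') a < m a].
    apply: contraR (red m um) => /existsPn le.
    by apply/mnm_lepP => a; rewrite leqNgt.
  exists a.
    by rewrite lep1mP -lt0n; apply: leq_ltn_trans lt.
  apply/allP => m' um'; apply/implyP => am'; apply/eqP/eqP/negPn/negP => mm'.
  have : (U_(a) <= \big[@mlcm n.+1/0%MM]_(m'' <- rem m u) m'')%MM.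
    rewrite dvd_big_lcm; apply/hasP; exists m' => //.
    by rewrite mem_rem_uniq // inE mm'.
  by rewrite lep1mP -lt0n leqNgt (leq_trans lt) // u1.
have [a am pa] := red m um; apply/negP => /mnm_lepP/(_ a) le.
have : (U_(a) <= \big[@mlcm n.+1/0%MM]_(m'' <- rem m u) m'')%MM.
  by rewrite lep1mP -lt0n; apply: leq_trans le; rewrite lt0n -lep1mP.
rewrite dvd_big_lcm => /hasP[m']; rewrite mem_rem_uniq // inE => /andP[m'm um'] am'.
by rewrite (privateP pa um' am') eqxx in m'm.
Qed.
End Monomials.

(** * The orders on vertices and on monomials *)

Section Order.
Variables (n : nat) (T : rel 'I_n.+1) (L : nat -> seq 'I_n.+1).
Implicit Types (v w a b t : 'I_n.+1) (m : 'X_{1..n.+1}).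
Local Notation vgt := (vgt T L).
Local Notation mgt := (mgt T L).

Lemma vgt_irr : irreflexive vgt.
Proof. by move=> v; rewrite /Defs.vgt !ltnn andbF. Qed.

Lemma vgt_trans : transitive vgt.
Proof.
move=> w v t; rewrite /Defs.vgt => /orP[vw|/andP[/eqP -> vw]].
  case/orP=> [wt|/andP[/eqP <- _]]; first by rewrite (ltn_trans vw wt).
  by rewrite vw.
case/orP=> [-> //|/andP[/eqP rwt wt]].
by rewrite -rwt eqxx (ltn_trans vw wt) orbT.
Qed.

Lemma vgt_asym v w : vgt v w -> vgt w v = false.
Proof. by move=> vw; apply/negP => /(vgt_trans vw); rewrite vgt_irr. Qed.

Lemma vgt_neq v w : vgt v w -> v != w.
Proof. by apply: contraTneq => ->; rewrite vgt_irr. Qed.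

Lemma vgt_rank v w : vgt v w -> rank T v <= rank T w.
Proof. by case/orP=> [/ltnW|/andP[/eqP ->]]. Qed.

Lemma vgt_of_rank v w : rank T v < rank T w -> vgt v w.
Proof. by rewrite /Defs.vgt => ->. Qed.

Lemma vgt_total v w : rank_listing T L -> v != w -> vgt v w || vgt w v.
Proof.
move=> hL vw; rewrite /Defs.vgt; case: ltngtP => //= rvw.
have [_ memL] := hL (rank T v).
rewrite -rvw -neq_ltn; apply: contra_neq vw => ivw.
rewrite -[v](nth_index v (s := L (rank T v))) ?memL ?eqxx //.
by rewrite ivw nth_index // memL rvw.
Qed.

Lemma mgt_asym m m' : rank_listing T L -> mgt m m' -> ~~ mgt m' m.
Proof.
move=> hL /existsP[v /andP[mv /forallP eqv]].
apply/negP => /existsP[w /andP[mw /forallP eqw]].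
have [vw|/(vgt_total hL)/orP[vw|wv]] := eqVneq v w.
- by move: mv; rewrite vw ltnNge (ltnW mw).
- by move: mv; move/implyP: (eqw v) => /(_ vw)/eqP ->; rewrite ltnn.
- by move: mw; move/implyP: (eqv w) => /(_ wv)/eqP ->; rewrite ltnn.
Qed.

Lemma mgt_edge_mon x y z w : rank_listing T L -> vgt x z -> vgt z w ->
  mgt (edge_mon x y) (edge_mon z w).
Proof.
move=> hL.
wlog xy : x y / (x == y) || vgt x y.
  move=> IH xz zw.
  have [xy|/(vgt_total hL)/orP[xy|yx]] := eqVneq x y.
  - by apply: IH; rewrite // xy eqxx.
  - by apply: IH; rewrite ?xy ?orbT.
  - by rewrite edge_monC; apply: IH; rewrite ?yx ?orbT // (vgt_trans yx).
(* The larger vertex [x] of the first edge is where the two monomials first differ. *)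
move=> xz zw; apply/existsP; exists x.
have xw := vgt_trans xz zw.
have z0 t : vgt t x || (t == x) -> edge_mon z w t = 0.
  move=> tx; have xt s : vgt x s -> (s == t) = false.
    move=> xs; apply/eqP => st; move: tx; rewrite -st.
    by rewrite eq_sym (negbTE (vgt_neq xs)) (vgt_asym xs).
  by rewrite edge_monE !xt.
rewrite (z0 x) ?eqxx ?orbT // {1}edge_monE eqxx ltn_addr //=.
apply/forallP => t; apply/implyP => tx; rewrite z0 ?tx // edge_monE.
have ty : vgt t y by case/orP: xy => [/eqP <- //|]; apply: vgt_trans.
by rewrite ![_ == t]eq_sym (negbTE (vgt_neq tx)) (negbTE (vgt_neq ty)).
Qed.

Lemma edge_sequenceP m :
  reflect (exists v w, T v w /\ m = edge_mon v w) (m \in edge_sequence T L).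
Proof.
rewrite mem_sort mem_undup; apply: (iffP mapP) => [[[v w]]|[v [w [Tvw ->]]]].
  by rewrite mem_enum inE /= => Tvw ->; exists v, w.
by exists (v, w); rewrite // mem_enum inE.
Qed.

Lemma edge_sequence_uniq : uniq (edge_sequence T L).
Proof. by rewrite sort_uniq undup_uniq. Qed.

Lemma ex_vgt_sorted (P : pred 'I_n.+1) : rank_listing T L ->
  exists2 c, sorted vgt c & c =i P.
Proof.
move=> hL; pose vge v w := (v == w) || vgt v w.
have vge_trans : transitive vge.
  move=> w v t /orP[/eqP -> //|vw] /orP[/eqP <-|wt]; rewrite /vge ?vw ?orbT //.
  by rewrite (vgt_trans vw wt) orbT.
have vge_total : total vge.
  move=> v w; rewrite /vge; case: (eqVneq v w) => //= /(vgt_total hL).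
  by case/orP=> ->; rewrite ?orbT.
exists (sort vge (enum P)); last by move=> v; rewrite mem_sort mem_enum.
have := sort_sorted vge_total (enum P).
have : uniq (sort vge (enum P)) by rewrite sort_uniq enum_uniq.
rewrite uniq_pairwise !sorted_pairwise //; last exact: vgt_trans.
move=> u1 u2; have : pairwise [rel v w | (v != w) && vge v w] (sort vge (enum P)).
  by rewrite pairwise_relI u1.
by apply: sub_pairwise => v w /= /andP[/negbTE vw]; rewrite /vge vw.
Qed.

Lemma mul_X_edge_ideal (K : fieldType) v w : T v w ->
  edge_ideal T ('X_v * 'X_w : {mpoly K[n.+1]})%R.
Proof.
move=> Tvw; exists (fun m => if m == edge_mon v w then 1%R else 0%R).
rewrite (bigD1_seq (edge_mon v w)) ?undup_uniq //=; last first.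
  by have /edge_sequenceP : exists a b, T a b /\ edge_mon v w = edge_mon a b
    by [exists v, w]; rewrite mem_sort.
rewrite eqxx big1 => [|m /negbTE ->]; last by rewrite GRing.mul0r.
by rewrite GRing.mul1r GRing.addr0 /edge_mon mpolyXD.
Qed.
End Order.

(** * Centres of the stars of a symbol *)

Section Symbols.
Variables (K : fieldType) (n : nat) (T : rel 'I_n.+1) (L : nat -> seq 'I_n.+1).
Hypotheses (hT : tree T) (hL : rank_listing T L).
Variable u : seq 'X_{1..n.+1}.
Hypothesis hu : symbol T L u.
Implicit Types (v w a b t : 'I_n.+1) (m : 'X_{1..n.+1}).
Local Notation vgt := (vgt T L).
Local Notation mgt := (mgt T L).

Lemma adj_sym v w : T v w = T w v.
Proof. by have [-> _ _ _] := hT. Qed.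

Lemma adj_neq v w : T v w -> v != w.
Proof. by have [_ Ti _ _] := hT; apply: contraTneq => ->; rewrite Ti. Qed.

Lemma symbol_edge m : m \in u -> exists v w, T v w /\ m = edge_mon v w.
Proof. by move/(mem_subseq hu)/edge_sequenceP. Qed.

Lemma symbol_adj v w : edge_mon v w \in u -> T v w.
Proof.
case/symbol_edge=> a [b [Tab E]].
have : (U_(v) <= edge_mon a b)%MM by rewrite -E dvd_edge_mon eqxx.
rewrite dvd_edge_mon => /orP[]/eqP va; move: E; rewrite va.
  by rewrite ![edge_mon a _]edge_monC => /edge_mon_inj ->.
by rewrite edge_monC => /edge_mon_inj ->; rewrite adj_sym.
Qed.

Lemma symbol_dvd m t : m \in u -> (U_(t) <= m)%MM -> exists2 s, T t s & m = edge_mon t s.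
Proof.
case/symbol_edge=> v [w [Tvw ->]]; rewrite dvd_edge_mon => /orP[]/eqP ->.
  by exists w.
by exists v; rewrite 1?adj_sym 1?edge_monC.
Qed.

Lemma symbol_reducedP :
  reduced u <-> {in u, forall m, exists2 a, (U_(a) <= m)%MM & private u a m}.
Proof.
apply: reducedP; first exact: subseq_uniq hu (edge_sequence_uniq T L).
by move=> m /symbol_edge[v [w [/adj_neq vw ->]]] t; apply: edge_mon_le1.
Qed.

(** The last hypothesis gives two clauses of a gap at once: [xy > zw], and the
    absence of monomials divisible by [y] below [zw]. *)
Lemma symbol_gap x y z w : uniq [:: x; y; z; w] ->
    edge_mon x y \in u -> edge_mon z w \in u -> T x z -> edge_mon x z \notin u ->
    private u w (edge_mon z w) ->
    {in u, forall m, (U_(y) <= m)%MM -> mgt m (edge_mon z w)} ->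
  has_gap T L K u.
Proof.
move=> uq xyu zwu Txz xzu pw gy; exists x, y, z, w.
split=> //; split; split=> //.
- by apply: gy; rewrite // dvd_edge_mon eqxx orbT.
- exact: mul_X_edge_ideal.
- by move=> m um; apply: contraNN => /(privateP pw um)/eqP.
- by move=> m um zwm; apply: contraL zwm => /(gy _ um)/(mgt_asym hL).
Qed.

(** The last clause breaks the tie when [va] is a whole star of [u], both of its
    vertices being private. *)
Definition center_of_edge v a :=
  [&& edge_mon v a \in u, private u a (edge_mon v a) &
      private u v (edge_mon v a) ==> vgt v a].

Definition center v := [exists a, center_of_edge v a].

Lemma ex_center m : reduced u -> m \in u ->
  exists v a, center_of_edge v a /\ m = edge_mon v a.
Proof.
move=> /symbol_reducedP red um; have [a am pa] := red m um.
have [v Tav mE] := symbol_dvd um am; move: um pa {am}; rewrite mE => um pa.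
have [pv|npv] := boolP (private u v (edge_mon v a)); last first.
  exists v, a; split; last exact: edge_monC.
  by rewrite /center_of_edge (negbTE npv) [edge_mon v a]edge_monC um pa.
have /orP[av|va] := vgt_total hL (adj_neq Tav).
  by exists a, v; rewrite /center_of_edge um av implybT [edge_mon a v]edge_monC pv.
exists v, a; split; last exact: edge_monC.
by rewrite /center_of_edge va implybT [edge_mon v a]edge_monC um pa.
Qed.

Lemma leaf_inj v w a : private u a (edge_mon v a) -> edge_mon w a \in u -> w = v.
Proof.
move=> pa wau; apply: edge_mon_inj (privateP pa wau _).
by rewrite dvd_edge_mon eqxx orbT.
Qed.

Lemma center_neq_leaf v w a b :
  center_of_edge v a -> center_of_edge w b -> a != w.
Proof.
case/and3P=> _ pa va_tie /and3P[wbu pb wb_tie]; apply/eqP => aw; subst a.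
(* Otherwise the two edges coincide, and the tie would be broken both ways. *)
have bv : b = v by apply: (leaf_inj pa); rewrite edge_monC.
subst b; move: va_tie wb_tie.
by rewrite [edge_mon w v]edge_monC pa edge_monC pb /= => /vgt_asym ->.
Qed.

Lemma vgt_mgt v w b m : vgt v w -> vgt w b -> m \in u -> (U_(v) <= m)%MM ->
  mgt m (edge_mon w b).
Proof. by move=> vw wb um /(symbol_dvd um)[s _ ->]; apply: mgt_edge_mon. Qed.

Hypotheses (red : reduced u) (nogap : ~ has_gap T L K u).

(** If the centres [v > w] were adjacent, the path [a - v - w - b] through their
    leaves would be a gap. *)
Lemma centers_indep v w : center v -> center w -> ~~ T v w.
Proof.
move=> cv cw; apply/negP => Tvw.
wlog vw : v w cv cw Tvw / vgt v w.
  move=> IH; have /orP[vw|wv] := vgt_total hL (adj_neq Tvw).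
    exact: IH vw.
  by apply: IH cw cv _ wv; rewrite adj_sym.
move: cv cw => /existsP[a va] /existsP[b wb]; apply: nogap.
have aw := center_neq_leaf va wb; have bv := center_neq_leaf wb va.
have [vau pa _] := and3P va; have [wbu pb _] := and3P wb.
have Twb := symbol_adj wbu.
have w_b : vgt w b.
  apply: vgt_of_rank; rewrite ltnNge; apply/negP => rb; case/eqP: bv.
  by apply: (neighbor_rank_le_inj hT) Twb _ rb (vgt_rank vw); rewrite adj_sym.
apply: (@symbol_gap v a w b) => //.
- have ab : a != b.
    by apply: contraTneq wbu => <-; apply: contraTN vw => /(leaf_inj pa) ->; rewrite vgt_irr.
  rewrite /= !inE !negb_or aw ab (adj_neq Twb) (adj_neq Tvw) (adj_neq (symbol_adj vau)).
  by rewrite eq_sym bv.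
(* An edge [vw] in [u] would have a private vertex, although [v] also lies on
   [va] and [w] on [wb]. *)
- apply/negP => vwu; have /symbol_reducedP/(_ _ vwu)[t] := red.
  rewrite dvd_edge_mon => /orP[]/eqP -> pt.
    rewrite [edge_mon v w]edge_monC in pt.
    by case/eqP: aw; apply: (leaf_inj pt); rewrite edge_monC.
  by case/eqP: bv; apply: (leaf_inj pt); rewrite edge_monC.
- move=> m um /(privateP pa um) ->; exact: mgt_edge_mon.
Qed.

(** If [w] came after [v], the path [v - a - w - b], with [b] a leaf of [w], would
    be a gap.  This is the case whether [v] is the parent of [a] or both [v] and
    [w] are children of [a]; [w] cannot be the parent, since then [v] would be a
    child of [a] and hence smaller than [w]. *)
Lemma center_last v w a : center_of_edge v a -> center w -> T a w -> ~~ vgt v w.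
Proof.
move=> va cw Taw; apply/negP => vw; apply: nogap.
have /existsP[b wb] := cw.
have [vau pa _] := and3P va; have [wbu pb _] := and3P wb.
have Twb := symbol_adj wbu; have Tva := symbol_adj vau.
have ab : a != b.
  by apply: contraTneq wbu => <-; apply: contraTN vw => /(leaf_inj pa) ->; rewrite vgt_irr.
have raw : rank T a <= rank T w.
  rewrite leqNgt; apply/negP => rwa; case/eqP: (vgt_neq vw).
  apply: (neighbor_rank_le_inj hT _ Taw); rewrite 1?adj_sym //; last exact: ltnW.
  by apply: leq_trans (vgt_rank vw) (ltnW rwa).
have w_b : vgt w b.
  apply: vgt_of_rank; rewrite ltnNge; apply/negP => rb; case/eqP: ab.
  by apply: (neighbor_rank_le_inj hT _ Twb) => //; rewrite adj_sym.
apply: (@symbol_gap a v w b) => //.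
- rewrite /= !inE !negb_or ab (adj_neq Taw) (adj_neq Twb) (vgt_neq vw).
  by rewrite (vgt_neq (vgt_trans vw w_b)) eq_sym (adj_neq Tva).
- by rewrite edge_monC.
- by rewrite edge_monC; apply: contraTN vw => /(leaf_inj pa) ->; rewrite vgt_irr.
- by move=> m um vm; apply: vgt_mgt vm.
Qed.

End Symbols.

(** * Cancellation and the characterization *)

Lemma mem_star n (T : rel 'I_n.+1) L v m :
  (m \in star T L v) = (U_(v) <= m)%MM && (m \in edge_sequence T L).
Proof. by rewrite mem_filter. Qed.

(** Two surviving edges meeting at [a] and selected through [v] and [w]: if [v]
    came strictly earlier than [w] in [c], the edge of [v] would be cancelled
    because of that of [w], and vice versa. *)
Lemma stars_cancel_same_center n (T : rel 'I_n.+1) L (c : seq 'I_n.+1) v w a m m' :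
    v \in c -> w \in c ->
    m \in stars_cancel T L c -> m' \in stars_cancel T L c ->
    (U_(v) <= m)%MM -> (U_(w) <= m')%MM ->
    (U_(a) <= m)%MM -> (U_(a) <= m')%MM ->
  v = w.
Proof.
wlog vw : v w m m' / index v c <= index w c.
  by move=> IH *; case: (leqP (index v c) (index w c)) => [|/ltnW] le;
    [apply: (IH v w m m') | apply/esym/(IH w v m' m)].
move=> vc wc; rewrite !mem_filter => /and3P[ncan _ em] /and3P[_ um' em'] vm wm' am am'.
move: vw; rewrite leq_eqVlt => /orP[/eqP|] vw.
  by rewrite -(nth_index v vc) vw nth_index.
case/negP: ncan.
have hv : index v c < size c by rewrite index_mem.
have hw : index w c < size c by rewrite index_mem.
apply/existsP; exists (Ordinal hv); apply/existsP; exists (Ordinal hw).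
rewrite !(tnth_nth v) /= !nth_index // vw !mem_star vm em /=.
apply/hasP; exists m'; first by rewrite mem_filter um'.
rewrite mem_star wm' em' /=.
rewrite /mcoprime negb_forall; apply/existsP; exists a.
by rewrite -lt0n leq_min !lt0n -!lep1mP am am'.
Qed.

Theorem proposition3p12 (K : fieldType) (n : nat) (T : rel 'I_n.+1)
    (L : nat -> seq 'I_n.+1) (hT : tree T) (hL : rank_listing T L)
    (u : seq 'X_{1..n.+1}) (hu : symbol T L u) :
  F_admissible T L K u <-> reduced u /\ ~ has_gap T L K u.
Proof.
split=> [[c [_ indep uc nogap]]|[red nogap]].
  split=> //; apply/(symbol_reducedP hT hu) => m um.
  have cu := mem_subseq uc.
  have /hasP[v vc] : has (fun v => m \in star T L v) c.
    by have := cu _ um; rewrite !mem_filter => /and3P[].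
  rewrite mem_star => /andP[vm _].
  have [a Tva mE] := symbol_dvd hT hu um vm.
  have am : (U_(a) <= m)%MM by rewrite mE dvd_edge_mon eqxx orbT.
  (* The end of [m] that was not selected is private. *)
  exists a => //; apply/allP => m' um'; apply/implyP => am'.
  have /hasP[w wc] : has (fun v => m' \in star T L v) c.
    by have := cu _ um'; rewrite !mem_filter => /and3P[].
  rewrite mem_star => /andP[wm' _].
  have vw := stars_cancel_same_center vc wc (cu _ um) (cu _ um') vm wm' am am'.
  have [b Tab m'E] := symbol_dvd hT hu um' am'.
  move: wm'; rewrite -vw m'E dvd_edge_mon => /orP[]/eqP vE.
    by have := adj_neq hT Tva; rewrite vE eqxx.
  by rewrite mE vE edge_monC.
have [c sc cE] := ex_vgt_sorted (center T L u) hL.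
have indep : {in c &, forall v w, ~~ T v w}.
  by move=> v w; rewrite !cE; apply: (centers_indep hT hL hu red nogap).
exists c; split=> //.
rewrite /stars_cancel /stars_union !subseq_filter -/(symbol T L u) andbA.
apply/andP; split=> //; rewrite -all_predI; apply/allP => m um /=.
have [v [a [va mE]]] := ex_center hT hL hu red um.
have vc : v \in c by rewrite cE; apply/existsP; exists a.
have em := mem_subseq hu um.
have Tva : T v a by apply: (symbol_adj hT hu); rewrite -mE.
apply/andP; split; last first.
  by apply/hasP; exists v; rewrite // mem_star em mE dvd_edge_mon eqxx.
apply/existsP => -[h /existsP[k /and3P[hk]]].
set x := tnth _ h; set w := tnth _ k.
have xc : x \in c by exact: mem_tnth.
have wc : w \in c by exact: mem_tnth.
have xw : vgt T L x w.
  rewrite /x /w !(tnth_nth v); apply: (sorted_ltn_nth (@vgt_trans _ T L)) => //;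
  by rewrite inE.
rewrite mem_star mE dvd_edge_mon => /andP[/orP[]/eqP xE _]; last first.
  by have := indep _ _ vc xc; rewrite xE Tva.
case/hasP=> m' _ /andP[]; rewrite mem_star => /andP[wm' /edge_sequenceP[p [q [Tpq m'E]]]].
rewrite /mcoprime negb_forall => /existsP[t]; rewrite -lt0n leq_min !lt0n -!lep1mP.
have [s Tws {}m'E] : exists2 s, T w s & m' = edge_mon w s.
  move: wm'; rewrite m'E dvd_edge_mon => /orP[]/eqP ->; first by exists q.
  by exists p; rewrite 1?(adj_sym hT) 1?edge_monC.
rewrite m'E !dvd_edge_mon => /andP[/orP[]/eqP -> /orP[]/eqP].
- by move=> vw; have := vgt_neq xw; rewrite xE vw eqxx.
- by move=> vs; have := indep _ _ wc vc; rewrite vs Tws.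
- by move=> aw; have := indep _ _ vc wc; rewrite -aw Tva.
move=> as_eq; rewrite -xE in va; move: xw; apply/negP.
by apply: (center_last hT hL hu nogap va); rewrite ?as_eq 1?(adj_sym hT) // -[center _ _ _ _]cE.
Qed.
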